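(* Let $(\mathscr{X}_i,\rho_i)$, $i=1,2$, be metric spaces, and let $\rho_3((u,x),(v,y))=\max\{\rho_1(u,v),\rho_2(x,y)\}$ on $\mathscr{X}_1\times\mathscr{X}_2$. Let $\alpha>0$ and $G_i\subset\mathscr{X}_i$, $i=1,2$. (i) If $G_1$ supports a probability measure $\mu$ such that $$\mu(B_{\rho_1}(a,r))\le\mathfrak{c}_1r^{\gamma}\quad\text{for all }a\in G_1\text{ and all }0<r\le\operatorname{diam}(G_1),$$ for some positive constants $\mathfrak{c}_1$ and $\gamma$, then there exists a constant $\mathfrak{c}_2>0$ such that $$\mathcal{C}_{\rho_2}^{\alpha-\gamma}(G_2)\le\mathfrak{c}_2\,\mathcal{C}_{\rho_3}^{\alpha}(G_1\times G_2).$$ (ii) If there exist constants $\gamma'<\alpha$ and $\mathfrak{c}_3>0$ such that $$N_{\rho_1}(G_1,r)\le\mathfrak{c}_3r^{-\gamma'}\quad\text{for all }0<r\le\operatorname{diam}(G_1),$$ then for some constant $\mathfrak{c}_4>0$ $$\mathcal{H}_{\rho_3}^{\alpha}(G_1\times G_2)\le\mathfrak{c}_4\,\mathcal{H}_{\rho_2}^{\alpha-\gamma'}(G_2).$$ Similar estimates hold with the roles of $G_1$ and $G_2$ exchanged: if $G_2$ (with $\rho_2$) satisfies the hypothesis of (i), respectively of (ii), then there exist positive constants $\mathfrak{c}_5$, respectively $\mathfrak{c}_6$, such that $$\mathcal{C}_{\rho_1}^{\alpha-\gamma}(G_1)\le\mathfrak{c}_5\,\mathcal{C}_{\rho_3}^{\alpha}(G_1\times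 G_2),\qquad\text{respectively}\qquad\mathcal{H}_{\rho_3}^{\alpha}(G_1\times G_2)\le\mathfrak{c}_6\,\mathcal{H}_{\rho_1}^{\alpha-\gamma'}(G_1).$$
   Context: $B_\rho(a,r)$ is the open ball of center $a$ and radius $r$ in $(\mathscr{X},\rho)$. $N_\rho(E,r)$ is the smallest number of open balls of radius $r$ required to cover $E$. For $G\subset(\mathscr{X},\rho)$ and $\beta>0$, $\mathcal{H}_\rho^\beta(G)=\lim_{\delta\to0}\inf\{\sum_{n}(2r_n)^\beta: G\subseteq\bigcup_{n} B_\rho(r_n),\ r_n\le\delta\}$, where $B_\rho(r)$ denotes an open ball of radius $r$. For $\beta\in\mathbb{R}$, $\mathcal{C}_\rho^\beta(G)=\big[\inf_{\mu\in\mathcal{P}(G)}\iint\varphi_\beta(\rho(u,v))\mu(du)\mu(dv)\big]^{-1}$, where $\mathcal{P}(G)$ is the set of (Borel) probability measures carried by $G$, and $\varphi_\beta(r)=r^{-\beta}$ if $\beta>0$, $\varphi_0(r)=\log\left(\frac{e}{r\wedge1}\right)$, $\varphi_\beta(r)=1$ if $\beta<0$ (with $\varphi_\beta(0)=\infty$ for $\beta\ge0$, $1/\infty=0$, $\inf\emptyset=\infty$). Thus $\mathcal{C}_\rho^\beta(G)=1$ for nonempty $G$ when $\beta<0$.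
   Formalization: The set assumed to satisfy the growth hypothesis is required not to be a single point in (i), and, if it is a single point, γ' ≥ 0 is required in (ii), likewise with roles exchanged: for a single point the condition on 0<r≤diam is vacuous and the claim fails. *)

(* Defs.v *)
From HB Require Import structures.
From mathcomp Require Import all_boot all_order all_algebra.
From mathcomp Require Import all_classical all_reals all_analysis.
Set Implicit Arguments.
Unset Strict Implicit.
Unset Printing Implicit Defensive.
Import Order.TTheory GRing.Theory Num.Theory.
Import numFieldNormedType.Exports.
Local Open Scope classical_set_scope.
Local Open Scope ring_scope.

(* [measurableType] requires an inhabited carrier, hence [Pointed]. *)
#[short(type="pmetricType")]
HB.structure Definition PointedMetric (R : numDomainType) :=
  {M of Metric R M & Pointed M}.

(* The library gives X * Y its product topology and product balls; this adds
   the maximum distance, which induces them. *)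
Section prod_metric.
Context {R : realType} {X Y : metricType R}.
Implicit Types p q : X * Y.

Definition prod_mdist p q : R := Num.max (mdist p.1 q.1) (mdist p.2 q.2).

Lemma prod_mdist_ge0 p q : 0 <= prod_mdist p q.
Proof. by rewrite /prod_mdist le_max mdist_ge0. Qed.

Lemma prod_mdist_positivity p q : prod_mdist p q = 0 -> p = q.
Proof.
case: p q => [u x] [v y] /= pq0.
have: prod_mdist (u, x) (v, y) <= 0 by rewrite pq0.
rewrite /prod_mdist ge_max /= => /andP[uv xy].
congr (_, _); apply: mdist_positivity; apply/eqP.
  by rewrite eq_le uv mdist_ge0.
by rewrite eq_le xy mdist_ge0.
Qed.

Lemma prod_ballEmdist p d : ball p d = [set q | prod_mdist p q < d].
Proof.
apply/seteqP; split => q; rewrite /prod_mdist /= gt_max.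
  by case; rewrite !ballEmdist /= => -> ->.
by move=> /andP[pq1 pq2]; split; rewrite ballEmdist.
Qed.

HB.instance Definition _ := @PseudoMetric_isMetric.Build R (X * Y)%type
  prod_mdist prod_mdist_ge0 prod_mdist_positivity prod_ballEmdist.

End prod_metric.

HB.instance Definition _ (R : realType) (X Y : pmetricType R) :=
  Pointed.on (X * Y)%type.

Section metric_measure_theory.
Context {R : realType} {X : pmetricType R}.
Implicit Types (G E : set X) (beta gamma r delta : R).
Local Open Scope ereal_scope.

(* The supremum over the empty set is -oo, so diam set0 = -oo; diameters are
   only used as upper bounds for positive radii. *)
Definition diam G : \bar R :=
  ereal_sup [set (mdist u v)%:E | u in G & v in G].

(* Equal to +oo if no finite family of balls of radius r covers E. *)
Definition covering_number E r : \bar R :=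
  ereal_inf [set n%:R%:E | n in
    [set n : nat | exists c : nat -> X, E `<=` \bigcup_(i < n) ball (c i) r]].

(* A ball of radius 0 is empty and contributes 0 to the sum for beta > 0, so
   finite covers are included. *)
Definition hausdorff_content beta delta G : \bar R :=
  ereal_inf [set \sum_(0 <= n <oo) ((2 * cr.2 n) `^ beta)%:E | cr in
    [set cr : (nat -> X) * (nat -> R) |
      (forall n, 0 <= cr.2 n <= delta)%R /\
      G `<=` \bigcup_n ball (cr.1 n) (cr.2 n)]].

Definition hausdorff_measure beta G : \bar R :=
  lim (hausdorff_content beta delta G @[delta --> 0^'+]).

Local Notation borel := (g_sigma_algebraType (@open X)).

(* G need not be Borel: mu is carried by G when the complement of G is
   contained in a Borel set of measure 0. *)
Definition carried_by G : set (probability borel R) :=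
  [set mu : probability borel R | mu.-negligible (~` G : set borel)].

Definition riesz_kernel beta r : \bar R :=
  if (beta < 0)%R then 1
  else if r == 0%R then +oo
  else if beta == 0%R then (ln (expR 1 / Num.min r 1))%:E
  else (r `^ (- beta))%:E.

Definition energy beta (mu : probability borel R) : \bar R :=
  \int[mu]_u \int[mu]_v riesz_kernel beta (mdist (u : X) (v : X)).

(* In \bar R, 0^-1 = +oo, +oo^-1 = 0 and the infimum of set0 is +oo. *)
Definition capacity beta G : \bar R :=
  (ereal_inf [set energy beta mu | mu in carried_by G])^-1.

Definition supports_ball_growth G gamma : Prop :=
  exists2 mu, carried_by G mu & exists2 c, (0 < c)%R &
    forall a r, G a -> (0 < r)%R -> r%:E <= diam G ->
      mu (ball a r) <= (c * r `^ gamma)%:E.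

Definition covering_growth G gamma : Prop :=
  exists2 c, (0 < c)%R &
    forall r, (0 < r)%R -> r%:E <= diam G ->
      covering_number G r <= (c * r `^ (- gamma))%:E.

End metric_measure_theory.

(* Main.v *)
(* For (i), let [mu] be the growth measure on [G1] and [nu] any probability
   carried by [G2].  Cutting [max (d(u, x), s)] into dyadic layers, each of
   which lies in a ball of comparable radius, gives
     int K_alpha (max (d(u, x), s)) mu(dx) <= C K_(alpha - gamma) (s)
   uniformly in [u] in [G1], where [K_beta] is the Riesz kernel.  Integrating
   against [nu x nu] bounds the alpha-energy of the product of [mu] and [nu] by
   [C] times the (alpha - gamma)-energy of [nu].

   For (ii), a ball of radius [r] in a cover of [G2] is replaced by its
   products with [N(G1, r) <= c r^-gamma'] balls of the same radius covering
   [G1]; these are balls of the maximum distance and their contribution is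
   [N(G1, r) (2 r)^alpha <= c 2^gamma' (2 r)^(alpha - gamma')]. *)

Require Import Defs.
From HB Require Import structures.
From mathcomp Require Import all_boot all_order all_algebra.
From mathcomp Require Import all_classical all_reals all_analysis.
From mathcomp Require Import measurable_realfun giry ring lra.
Set Implicit Arguments.
Unset Strict Implicit.
Unset Printing Implicit Defensive.
Import Order.TTheory GRing.Theory Num.Theory.
Import numFieldNormedType.Exports.
Local Open Scope classical_set_scope.
Local Open Scope ring_scope.
Local Open Scope ereal_scope.

(** * Borel maps and products of Borel probabilities *)

Local Notation borel X := (g_sigma_algebraType (@open X)).

Lemma prod_mdistE (R : realType) (X Y : metricType R) (p q : X * Y) :
  mdist p q = Num.max (mdist p.1 q.1) (mdist p.2 q.2).
Proof. by []. Qed.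

Section borel_maps.
Context {R : realType}.
Implicit Types X Y Z : pmetricType R.

Lemma lipschitz1_continuous (X Y : metricType R) (f : X -> Y) :
  (forall x y, (mdist (f x) (f y) <= mdist x y)%R) -> continuous f.
Proof.
move=> f1 x; apply/cvg_ballP => e e0; rewrite near_simpl.
apply/nbhs_ballP; exists e => //= y.
by rewrite !ballEmdist /=; apply: le_lt_trans.
Qed.

Lemma open_measurable_borel X (A : set X) :
  open A -> measurable (A : set (borel X)).
Proof. by move=> oA; apply: sub_sigma_algebra. Qed.

Lemma continuous_measurable_borel X Y (f : X -> Y) : continuous f ->
  measurable_fun [set: borel X] (f : borel X -> borel Y).
Proof.
move=> /continuousP cf;
  apply: (@measurability _ _ (borel X) (borel Y) setT f (@open Y)) => //.
move=> _ [A oA <-].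
by rewrite setTI; apply: open_measurable_borel; apply: cf.
Qed.

Lemma continuous_measurable_borelR X (f : X -> R) : continuous f ->
  measurable_fun [set: borel X] (f : borel X -> R).
Proof.
move=> /continuousP cf; apply: (measurability _ (RGenOpens.measurableE R)).
move=> _ [_ [a [b ->] <-]].
by rewrite setTI; apply: open_measurable_borel; apply/cf/interval_open.
Qed.

Lemma open_mball (X : metricType R) (x : X) r : open (ball x r).
Proof.
rewrite openE => y; rewrite ballEmdist /= => xyr.
apply/nbhs_ballP; exists (r - mdist x y)%R => /=; first by rewrite subr_gt0.
move=> z; rewrite !ballEmdist /= => yz.
by apply: le_lt_trans (metric_triangle x y z) _; rewrite addrC -ltrBrDr.
Qed.

Lemma continuous_mdist (X : metricType R) :
  continuous (fun p : X * X => mdist p.1 p.2).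
Proof.
move=> [x y]; apply/(@cvgrPdist_lt _ R^o) => e e0.
apply/(@nbhs_ballP R (X * X)%type); exists (e / 2)%R => /=;
  first by rewrite divr_gt0.
move=> [u v] []; rewrite !ballEmdist /= => xu yv.
rewrite [e]splitr; apply: le_lt_trans (ltrD xu yv).
rewrite ler_norml; apply/andP; split.
  rewrite lerNl opprB lerBlDr.
  apply: le_trans (metric_triangle u x v) _; rewrite (metric_sym u x).
  rewrite -addrA lerD2l addrC; exact: metric_triangle.
rewrite lerBlDr; apply: le_trans (metric_triangle x u y) _.
rewrite -addrA lerD2l addrC (metric_sym y v); exact: metric_triangle.
Qed.

Lemma continuous_mdistr (X : metricType R) (u : X) : continuous (mdist u).
Proof.
move=> x; apply: (@continuous_comp _ _ _ (pair u) (fun p => mdist p.1 p.2)).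
  apply: lipschitz1_continuous => {}x y.
  by rewrite prod_mdistE /= mdistxx max_r ?mdist_ge0.
exact: continuous_mdist.
Qed.

End borel_maps.

Lemma probability_integral_cst d (T : measurableType d) (R : realType)
    (P : probability T R) (c : \bar R) : \int[P]_x c = c.
Proof. by rewrite integral_cst//= probability_setT mule1. Qed.

(* No separability is assumed, so the Borel sets of [Z] need not be generated
   by rectangles: sections of open sets are treated through lower
   semicontinuity instead. *)
Section fiber_measure.
Context {R : realType} {X Y Z : pmetricType R} (j : X -> Y -> Z).
Hypothesis jl : forall x x' y, (mdist (j x y) (j x' y) <= mdist x x')%R.
Hypothesis jr : forall x y y', (mdist (j x y) (j x y') <= mdist y y')%R.

Let mjl y : measurable_fun [set: borel X] (j^~ y : borel X -> borel Z).
Proof.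
apply: continuous_measurable_borel; apply: lipschitz1_continuous => x x'.
exact: jl.
Qed.

(** Moving [y] by less than $1/(n+1)$ moves [j x y] by less than that, so points well inside [A]
    stay in [A]; continuity of [mu] from below along these inner sets keeps the mass above [a]. *)
Lemma fiber_measure_lsc (mu : giry (borel X) R) (A : set Z) : open A ->
  lower_semicontinuous (fun y => mu ((j^~ y) @^-1` A)).
Proof.
move=> oA y a ay.
(* [F n] is the part of [A] at depth more than $1/(n+1)$; the strict inequality makes it open, since
   half of the slack can be given up. *)
pose F n := [set z | exists2 e, (n.+1%:R^-1 < e)%R & ball z e `<=` A].
have oF n : open (F n).
  rewrite openE => z [e ne zeA]; apply/nbhs_ballP.
  exists ((e - n.+1%:R^-1) / 2)%R => /=; first by rewrite divr_gt0// subr_gt0.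
  move=> w zw; exists (e - (e - n.+1%:R^-1) / 2)%R.
    rewrite -subr_gt0.
    have -> : (e - (e - n.+1%:R^-1) / 2 - n.+1%:R^-1 = (e - n.+1%:R^-1) / 2)%R.
      by field; rewrite addrC natr1.
    by rewrite divr_gt0// subr_gt0.
  move=> v wv; apply: zeA.
  by have := ball_triangle zw wv; rewrite addrC subrK.
have FA : \bigcup_n F n = A.
  apply/seteqP; split => [z [n _ [e ne zeA]]|z Az].
    by apply/zeA/ballxx; apply: lt_trans ne; rewrite invr_gt0.
  have := oA; rewrite openE => /(_ _ Az) /nbhs_ballP[e /= e0 zeA].
  exists (Num.truncn e^-1) => //; exists e => //.
  by rewrite invf_plt ?posrE// truncnS_gt.
pose E n : set (borel X) := (j^~ y) @^-1` F n.
have mE n : measurable (E n).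
  by rewrite -[E n]setTI; apply: mjl => //; exact: open_measurable_borel.
have EA : \bigcup_n E n = (j^~ y) @^-1` A by rewrite -FA preimage_bigcup.
have ndE : {homo E : n m / (n <= m)%N >-> (n <= m)%O}.
  move=> n m nm; apply/subsetPset => x [e ne xe]; exists e => //.
  by apply: le_lt_trans ne; rewrite lef_pV2 ?posrE// ler_nat ltnS.
have muE : mu (E n) @[n --> \oo] --> mu ((j^~ y) @^-1` A).
  by rewrite -EA; apply: nondecreasing_cvg_mu => //; exact: bigcup_measurable.
have [N _ /(_ N (leqnn N)) aN] : \forall n \near \oo, a%:E < mu (E n).
  exact: muE _ (open_ereal_gt' ay).
exists (ball y N.+1%:R^-1)%R.
  by apply/nbhs_ballP; exists N.+1%:R^-1%R => /=.
move=> y' yy'; apply: lt_le_trans aN _; apply: le_measure; rewrite ?inE //.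
  by rewrite -[X in measurable X]setTI; apply: mjl => //;
    exact: open_measurable_borel.
move=> x [e Ne] /(_ (j x y')); apply; rewrite ballEmdist /=.
apply: le_lt_trans (jr _ _ _) _; apply: lt_trans Ne.
by move: yy'; rewrite ballEmdist.
Qed.

(** Dynkin's theorem reduces the claim to open [A], where lower semicontinuity makes the superlevel
    sets open; complements use that [mu] is finite. *)
Lemma measurable_fiber_measure (mu : giry (borel X) R) (A : set (borel Z)) :
  measurable A -> measurable_fun [set: borel Y] (fun y => mu ((j^~ y) @^-1` A)).
Proof.
have mj (B : set (borel Z)) y : measurable B ->
    measurable ((j^~ y) @^-1` B : set (borel X)).
  by move=> mB; rewrite -[X in measurable X]setTI; apply: mjl.
move: A; apply: (@dynkin_induction _ (borel Z) (@open Z)) => //.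
- by move=> A B; apply: openI.
- by rewrite (_ : (fun _ => _) = cst (mu setT)).
- move=> A oA; apply: (measurability _ (ErealGenOInfty.measurableE R)).
  move=> _ [_ [a ->] <-]; rewrite setTI; apply: open_measurable_borel.
  by rewrite preimage_itvoy;
    have /lower_semicontinuousP := fiber_measure_lsc (mu := mu) oA; exact.
- move=> A mA mfA.
  rewrite (_ : (fun _ => _) = (fun y => mu setT - mu ((j^~ y) @^-1` A))).
    exact: emeasurable_funB.
  apply/funext => y; rewrite preimage_setC -setTD measureD ?setTI//;
    [exact: (mj setT)|exact: mj|].
  by rewrite ltey_eq fin_num_measure//; exact: (mj setT).
- move=> F mF tF mfF.
  rewrite (_ : (fun _ => _) = (fun y =>
    \sum_(0 <= k <oo) mu ((j^~ y) @^-1` F k))).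
    exact: ge0_emeasurable_sum.
  apply/funext => y; rewrite preimage_bigcup measure_bigcup//.
  - by apply: eq_eseriesl => k; rewrite in_setT.
  - by move=> k _; exact: mj.
  - apply/trivIsetP => m n _ _ mn; rewrite -preimage_setI.
    by move/trivIsetP : tF => -> //; rewrite preimage_set0.
Qed.

Let measurable_fiber_map (mu : giry (borel X) R) :
  measurable_fun [set: borel Y] (fun y => giry_map (mjl y) mu).
Proof.
by apply: measurable_giry_codensity => // B mB; exact: measurable_fiber_measure.
Qed.

Lemma measurable_fiber_integral (mu : giry (borel X) R)
    (f : borel Z -> \bar R) :
  measurable_fun [set: borel Z] f -> (forall z, 0 <= f z) ->
  measurable_fun [set: borel Y] (fun y => \int[mu]_x f (j x y)).
Proof.
move=> mf f0.
rewrite (_ : (fun _ => _) = giry_int ^~ f \o (fun y => giry_map (mjl y) mu)).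
  by apply: measurableT_comp;
    [exact: measurable_giry_int|exact: measurable_fiber_map].
by apply/funext => y /=; rewrite giry_int_map.
Qed.

(** [lam] stands in for the product measure on the full Borel sigma-algebra of [Z]: it mixes, with
    weight [nu], the push-forwards of [mu] along the maps [j^~ y]. *)
Lemma fiber_product_probability (mu : probability (borel X) R)
    (nu : probability (borel Y) R) :
  exists lam : probability (borel Z) R, forall f : borel Z -> \bar R,
    measurable_fun [set: borel Z] f -> (forall z, 0 <= f z) ->
    \int[lam]_z f z = \int[nu]_y \int[mu]_x f (j x y).
Proof.
pose m := giry_bind (nu : giry _ _) (measurable_fiber_map mu).
have mE (f : borel Z -> \bar R) : measurable_fun [set: borel Z] f ->
    (forall z, 0 <= f z) -> \int[m]_z f z = \int[nu]_y \int[mu]_x f (j x y).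
  move=> mf f0; rewrite [LHS]giry_int_bind//.
  by apply: eq_integral => y _; rewrite giry_int_map.
(* The bind is a priori only a subprobability, so its total mass has to be computed. *)
have m1 : m setT = 1.
  have := mE (cst 1) (@measurable_cst _ _ _ _ _ _) (fun=> lee01).
  rewrite integral_cst// mul1e => ->.
  rewrite -[RHS](probability_integral_cst nu); apply: eq_integral => y _.
  exact: probability_integral_cst.
pose P : probability (borel Z) R :=
  HB.pack (SubProbability.sort m) (SubProbability.class m)
    (isProbability.Build _ _ _ (SubProbability.sort m) m1).
by exists P.
Qed.

End fiber_measure.

(** * Riesz kernels and potentials *)

Section riesz_kernel.
Context {R : realType}.
Implicit Types (alpha beta gamma r s t : R).

Lemma riesz_kernel_ge0 beta r : 0 <= riesz_kernel beta r.
Proof.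
rewrite /riesz_kernel; case: ifP => // _; case: ifP => // r0; case: ifP => _.
  have [r_lt0|] := ltP r 0%R.
    rewrite ln0// min_l; last by rewrite (le_trans (ltW r_lt0)).
    by rewrite mulr_ge0_le0 ?expR_ge0 ?invr_le0 ?ltW.
  rewrite le_eqVlt eq_sym r0 /= => r_gt0; rewrite lee_fin ln_ge0//.
  have m0 : (0 < Num.min r 1)%R by rewrite lt_min r_gt0 ltr01.
  rewrite ler_pdivlMr// mul1r ge_min; apply/orP; right.
  by rewrite (le_trans _ (expR_ge1Dx 1))// lerDl.
by rewrite lee_fin powR_ge0.
Qed.

Lemma measurable_riesz_kernel beta :
  measurable_fun [set: R] (riesz_kernel beta).
Proof.
rewrite /riesz_kernel; case: (beta < 0)%R; first exact: measurable_cst.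
have meq0 : measurable_fun [set: R] (fun r : R => r == 0%R).
  by apply: measurable_fun_eqr => //; exact: measurable_cst.
case: (beta == 0)%R; last first.
  apply: measurable_fun_ifT => //.
  by apply/measurable_EFinP; exact: measurable_powR.
rewrite (_ : (fun r => _) = (fun r : R => if r == 0%R then +oo else
    (if (r < 0)%R then 0%R else (1 - ln (Num.min r 1))%R)%:E)).
  apply: measurable_fun_ifT => //.
  apply/measurable_EFinP; apply: measurable_fun_ifT.
  - by apply: measurable_fun_ltr => //; exact: measurable_cst.
  - exact: measurable_cst.
  - apply: measurable_funB; first exact: measurable_cst.
    apply: measurableT_comp; first exact: measurable_ln.
    by apply: measurable_minr => //; exact: measurable_cst.
apply/funext => r; case: ifPn => // r0; congr _%:E.
have [r_lt0|] := ltP r 0%R.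
  rewrite ln0// min_l; last by rewrite (le_trans (ltW r_lt0)).
  by rewrite mulr_ge0_le0 ?expR_ge0 ?invr_le0 ?ltW.
rewrite le_eqVlt eq_sym (negbTE r0) /= => r_gt0.
have m0 : (0 < Num.min r 1)%R by rewrite lt_min r_gt0 ltr01.
by rewrite ln_div ?posrE ?expR_gt0// expRK.
Qed.

Lemma riesz_kernelE alpha r : (0 < alpha)%R -> (0 < r)%R ->
  riesz_kernel alpha r = (r `^ (- alpha))%:E.
Proof.
by move=> a0 r0; rewrite /riesz_kernel !gt_eqF// ltNge (ltW a0).
Qed.

Lemma riesz_kernel_le alpha r s : (0 < alpha)%R -> (0 <= r)%R -> (r <= s)%R ->
  riesz_kernel alpha s <= riesz_kernel alpha r.
Proof.
move=> a0; rewrite le_eqVlt => /predU1P[<- _|r0 rs].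
  by rewrite [leRHS]/riesz_kernel ltNge (ltW a0) /= eqxx leey.
have s0 := lt_le_trans r0 rs.
rewrite !riesz_kernelE// lee_fin !powRN.
rewrite lef_pV2 ?posrE ?powR_gt0//.
by apply: ge0_ler_powR => //; rewrite ?nnegrE; apply: ltW.
Qed.

Lemma dyadic_bounds t : (1 <= t)%R -> exists k, (2 ^+ k <= t < 2 ^+ k.+1)%R.
Proof.
move=> t1; have ex : exists n, (t < 2 ^+ n)%R.
  exists (Num.truncn t).+1; apply: lt_le_trans (truncnS_gt t) _.
  by rewrite -natrX ler_nat ltnW// ltn_expl.
case: (ex_minnP ex) => -[|k] tk kmin.
  by move: tk; rewrite expr0 ltNge t1.
by exists k; rewrite tk andbT leNgt; apply/negP => /kmin; rewrite ltnn.
Qed.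

Lemma sum_if_ltn (v : R) n N :
  (\sum_(0 <= k < n) (if (k < N)%N then v else 0) = v *+ minn n N)%R.
Proof.
elim: n => [|n IH]; first by rewrite big_nil min0n.
rewrite big_nat_recr//= IH; have [nN|Nn] := ltnP n N.
  by rewrite (minn_idPl nN) mulrSr.
by rewrite (minn_idPr (leqW Nn)) addr0.
Qed.

Lemma nneseries_le_bound (f : nat -> R) (M : R) : (forall n, (0 <= f n)%R) ->
  (forall n, (\sum_(0 <= k < n) f k <= M)%R) ->
  \sum_(0 <= k <oo) (f k)%:E <= M%:E.
Proof.
move=> f0 fM; apply: lime_le.
  by apply: is_cvg_nneseries => n _ _; rewrite lee_fin.
by apply: nearW => n; rewrite sumEFin lee_fin.
Qed.

End riesz_kernel.

(** * Riesz potentials at a point of power growth *)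

Section potential.
Context {R : realType} {X : pmetricType R}.
Variables (mu : probability (borel X) R) (u : X) (c gamma : R).
Hypothesis c0 : (0 <= c)%R.
Hypothesis muball : forall r, (0 < r)%R -> mu (ball u r) <= (c * r `^ gamma)%:E.

(** The majorant is integrated term by term: the constant [a] keeps its value since [mu] has mass 1,
    and layer [k] costs at most $c\,w_k r_k^\gamma$. *)
Lemma layered_integral_le (f : borel X -> \bar R) (a M : R) (w r : nat -> R) :
  measurable_fun [set: borel X] f -> (forall x, 0 <= f x) ->
  (0 <= a)%R -> (forall k, (0 <= w k)%R) -> (forall k, (0 < r k)%R) ->
  (forall x, f x <= a%:E + \sum_(0 <= k <oo) (w k * \1_(ball u (r k)) x)%:E) ->
  (forall n, (\sum_(0 <= k < n) w k * r k `^ gamma <= M)%R) ->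
  \int[mu]_x f x <= (a + c * M)%:E.
Proof.
move=> mf f0 a0 w0 r0 fle wM.
have mb k : measurable (ball u (r k) : set (borel X)).
  by apply: open_measurable_borel; exact: open_mball.
pose g k (x : borel X) := (w k * \1_(ball u (r k)) x)%:E.
have mg k : measurable_fun [set: borel X] (g k).
  apply/measurable_EFinP; apply: measurable_funM; first exact: measurable_cst.
  exact: measurable_indic.
have g0 k x : 0 <= g k x by rewrite lee_fin mulr_ge0.
have mG : measurable_fun [set: borel X] (fun x => \sum_(0 <= k <oo) g k x).
  exact: ge0_emeasurable_sum.
have ig k : \int[mu]_x g k x <= (c * (w k * r k `^ gamma))%:E.
  rewrite /g; under eq_integral do rewrite EFinM.
  rewrite ge0_integralZl//; last 2 first.
  - by apply/measurable_EFinP; exact: measurable_indic.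
  - by rewrite lee_fin.
  rewrite integral_indic// setIT mulrCA EFinM lee_wpmul2l ?lee_fin//.
  exact: muball.
apply: (@le_trans _ _ (\int[mu]_x (a%:E + \sum_(0 <= k <oo) g k x))).
  apply: ge0_le_integral => //.
  by apply: emeasurable_funD => //; exact: measurable_cst.
rewrite ge0_integralD//; last first.
  by move=> x _; apply: nneseries_ge0 => k _ _.
rewrite probability_integral_cst integral_nneseries// EFinD leeD2l//.
apply: le_trans (_ : \sum_(0 <= k <oo) (c * (w k * r k `^ gamma))%:E <= _).
  by apply: lee_nneseries => [k _ _|k _]; [exact: integral_ge0|exact: ig].
apply: nneseries_le_bound => n.
  by rewrite !mulr_ge0// powR_ge0.
by rewrite -mulr_sumr ler_wpM2l.
Qed.

Lemma le_layers (z : \bar R) (a : R) (w r : nat -> R) x k :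
  (0 <= a)%R -> (forall n, (0 <= w n)%R) -> (mdist u x < r k)%R ->
  z <= (w k)%:E ->
  z <= a%:E + \sum_(0 <= n <oo) (w n * \1_(ball u (r n)) x)%:E.
Proof.
move=> a0 w0 xk zk; have t0 n : 0 <= (w n * \1_(ball u (r n)) x)%:E.
  by rewrite lee_fin mulr_ge0.
rewrite -[z]add0e; apply: leeD; first by rewrite lee_fin.
apply: le_trans (nneseries_lim_ge (P := xpredT) k.+1 (fun n _ _ => t0 n)).
rewrite big_nat_recr//= indicE mem_set ?mulr1; last by rewrite ballEmdist.
by apply: (le_trans zk); rewrite leeDr// sume_ge0.
Qed.

(** The cost of the layer at height [y], where the kernel is at most $y^{-\alpha}$ and which is
    enclosed in a ball of radius $4y$. *)
Lemma layer_weight (alpha y : R) : (0 < y)%R ->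
  (y `^ (- alpha) * (4 * y) `^ gamma = 4 `^ gamma * y `^ (- (alpha - gamma)))%R.
Proof.
move=> y0; rewrite powRM ?ltW// mulrCA -powRD ?(gt_eqF y0) ?implybT//.
by rewrite opprB addrC.
Qed.

Lemma dyadic_powR (beta s : R) k : (0 < s)%R ->
  ((s * 2 ^+ k) `^ (- beta) = s `^ (- beta) * (2 `^ (- beta)) ^+ k)%R.
Proof.
move=> s0; rewrite powRM ?(ltW s0) ?exprn_ge0//; congr (_ * _)%R.
by rewrite -powR_mulrn// powRAC powR_mulrn ?powR_ge0.
Qed.

Lemma geometric_sum_le (A delta : R) n : (0 <= A)%R -> (0 < delta)%R ->
  (\sum_(0 <= k < n) A * (2 `^ (- delta)) ^+ k <= A / (1 - 2 `^ (- delta)))%R.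
Proof.
move=> A0 d0; apply: (geometric_le_lim n A0); first exact: powR_gt0.
rewrite ger0_norm ?powR_ge0// powRN invf_lt1 ?powR_gt0//.
have : (1 `^ delta < 2 `^ delta :> R)%R.
  by apply: gt0_ltr_powR; rewrite ?nnegrE// ltr1n.
by rewrite powR1.
Qed.

Variable alpha : R.
Hypothesis alpha0 : (0 < alpha)%R.

Let kernel s (x : borel X) := riesz_kernel alpha (Num.max (mdist u x) s).

Let mkernel s : measurable_fun [set: borel X] (kernel s).
Proof.
apply: measurableT_comp; first exact: measurable_riesz_kernel.
apply: measurable_maxr; last exact: measurable_cst.
apply: continuous_measurable_borelR.
exact: continuous_mdistr.
Qed.

Let kernel_ge0 s x : 0 <= kernel s x. Proof. exact: riesz_kernel_ge0. Qed.

Let kernel_le (s y : R) x : (0 < y)%R -> (y <= Num.max (mdist u x) s)%R ->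
  kernel s x <= (y `^ (- alpha))%:E.
Proof.
by move=> y0 yx; rewrite -riesz_kernelE// riesz_kernel_le// ltW.
Qed.

(** When $\alpha>\gamma$, layer costs decay geometrically as the height $s2^k$ grows, so the lowest
    layer, of order $s^{-(\alpha-\gamma)}$, dominates. *)
Lemma riesz_potential_gt0 (s : R) : (0 < alpha - gamma)%R -> (0 < s)%R ->
  \int[mu]_x riesz_kernel alpha (Num.max (mdist u x) s) <=
  (c * (4 `^ gamma / (1 - 2 `^ (- (alpha - gamma)))))%:E
    * riesz_kernel (alpha - gamma) s.
Proof.
move=> b0 s0; set beta := (alpha - gamma)%R.
pose y k : R := (s * 2 ^+ k)%R.
have y0 k : (0 < y k)%R by rewrite mulr_gt0// exprn_gt0.
rewrite riesz_kernelE// -EFinM -mulrA -[X in X%:E]add0r.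
apply: (layered_integral_le (w := fun k => y k `^ (- alpha))
    (r := fun k => 4 * y k)%R) => //.
- exact: mkernel.
- by move=> x; exact: kernel_ge0.
- by move=> k; exact: powR_ge0.
- by move=> k; rewrite mulr_gt0.
- move=> x.
  have sx : (s <= Num.max (mdist u x) s)%R by rewrite le_max lexx orbT.
  (* The layer of [x] is the [k] with $s2^k\le\max(d(u,x),s)<s2^{k+1}$. *)
  have [|k /andP[kx xk]] := @dyadic_bounds _ (Num.max (mdist u x) s / s).
    by rewrite ler_pdivlMr// mul1r.
  move: kx xk; rewrite ler_pdivlMr// ltr_pdivrMr// => kx xk.
  apply: (@le_layers _ _ _ _ _ k) => //.
  + by move=> n; exact: powR_ge0.
  + apply: le_lt_trans (_ : Num.max (mdist u x) s < _)%R;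
    first by rewrite le_max lexx.
    apply: lt_trans xk _; have := y0 k.
    by rewrite (_ : 2 ^+ k.+1 * s = 2 * y k)%R; [lra|rewrite /y exprS; ring].
  + by apply: kernel_le => //; rewrite /y mulrC.
- move=> n; under eq_bigr do rewrite layer_weight// dyadic_powR// mulrA.
  apply: le_trans (geometric_sum_le _ _ _) _ => //.
    by rewrite mulr_ge0// powR_ge0.
  by rewrite mulrAC.
Qed.

Lemma riesz_potential_lt0 (s : R) : (alpha - gamma < 0)%R ->
  \int[mu]_x riesz_kernel alpha (Num.max (mdist u x) s) <=
  (1 + c * (4 `^ gamma / (1 - 2 `^ (- (gamma - alpha)))))%:E.
Proof.
move=> b0; pose y k : R := (2 ^- k.+1)%R.
have y0 k : (0 < y k)%R by rewrite invr_gt0 exprn_gt0.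
have w0 k : (0 <= y k `^ (- alpha))%R by exact: powR_ge0.
apply: (layered_integral_le (w := fun k => y k `^ (- alpha))
    (r := fun k => 4 * y k)%R) => //.
- exact: mkernel.
- by move=> x; exact: kernel_ge0.
- by move=> k; rewrite mulr_gt0.
- move=> x; apply: (@le_trans _ _ (riesz_kernel alpha (mdist u x))).
    by rewrite riesz_kernel_le ?mdist_ge0// le_max lexx.
  (* At distance 0 the kernel is infinite, but so is the majorant: [x] lies in every ball and every
     weight is at least 1. *)
  have [ux0|] := eqVneq (mdist u x) 0%R.
    rewrite [leRHS](_ : _ = +oo) ?leey//; apply: eq_infty => M.
    apply: (@le_trans _ _ (\sum_(0 <= k < (Num.truncn M).+1) 1)).
      by rewrite sumEFin big_const_nat iter_addr subn0 addr0 lee_fin ltW//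
        truncnS_gt.
    apply: (@le_trans _ _ (\sum_(0 <= k < (Num.truncn M).+1)
        (y k `^ (- alpha) * \1_(ball u (4 * y k)) x)%:E)).
      apply: lee_sum => k _; rewrite lee_fin indicE mem_set ?mulr1; last first.
        by rewrite ballEmdist /= ux0 mulr_gt0.
      rewrite powRN invf_ge1 ?powR_gt0// -[leRHS](powRr0 (y k)).
      by rewrite ger_powR ?y0 ?invf_le1 ?exprn_ege1 ?exprn_gt0 ?ler1n// ltW.
    rewrite -[leLHS]add0e; apply: leeD => //.
    by apply: nneseries_lim_ge => k _ _; rewrite lee_fin mulr_ge0.
  rewrite neq_lt ltNge mdist_ge0 /= => ux0.
  have [ux1|ux1] := leP 1%R (mdist u x).
    rewrite -[leLHS]adde0; apply: leeD; last first.
      by apply: nneseries_ge0 => k _ _; rewrite lee_fin mulr_ge0.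
    rewrite riesz_kernelE// lee_fin powRN invf_le1 ?powR_gt0//.
    by rewrite -(powRr0 (mdist u x)) ler_powR// ltW.
  (* Inverting the distance gives $2^{-(k+1)}<d(u,x)\le2^{-k}=2y_k$, so [x] lies in the ball of
     radius $4y_k$. *)
  have [|k /andP[kx xk]] := @dyadic_bounds _ (mdist u x)^-1.
    by rewrite invf_ge1// ltW.
  have yx : (y k <= mdist u x)%R.
    by rewrite /y -[leRHS]invrK lef_pV2 ?posrE ?invr_gt0 ?exprn_gt0// ltW.
  apply: (@le_layers _ _ _ _ _ k) => //.
  + rewrite /y exprS invfM mulrA ltr_pdivlMr ?exprn_gt0//.
    apply: (@le_lt_trans _ _ 1%R); last by lra.
    by rewrite mulrC -ler_pdivlMr// mul1r.
  + by rewrite -riesz_kernelE// riesz_kernel_le// ltW.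
- move=> n; apply: le_trans (geometric_sum_le n _ _);
  rewrite ?powR_ge0 ?subr_gt0//; last first.
    by rewrite -subr_lt0.
  apply: ler_sum => k _; rewrite layer_weight// ler_wpM2l ?powR_ge0// opprB.
  rewrite /y -exprVn -(powR_mulrn k.+1)// powRAC powR_mulrn ?powR_ge0//.
  rewrite -(powR_inv1 (ler0n _ 2)) -powRrM mulN1r exprS.
  (* The exponent [k.+1] leaves one extra factor $2^{-(\gamma-\alpha)}\le1$, which is discarded. *)
  apply: ler_piMl; first by rewrite exprn_ge0 ?powR_ge0.
  rewrite powRN invf_le1 ?powR_gt0// -[leLHS](powRr0 2) ler_powR ?ler1n//.
  by rewrite -oppr_le0 opprB ltW.
Qed.

(** When $\alpha=\gamma$ all layers cost the same, and for $s<1$ the number of dyadic layers between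
    [s] and 1 is at most a multiple of the logarithmic kernel $1+\log(1/s)$. *)
Lemma riesz_potential_eq0 (s : R) : (alpha - gamma = 0)%R -> (0 < s)%R ->
  \int[mu]_x riesz_kernel alpha (Num.max (mdist u x) s) <=
  (1 + c * 4 `^ gamma * (1 + (ln 2)^-1))%:E * riesz_kernel (alpha - gamma) s.
Proof.
move=> b0 s0.
have ln2 : (0 < ln 2 :> R)%R by rewrite ln_gt0// ltr1n.
have C0 : (0 <= c * 4 `^ gamma * (1 + (ln 2)^-1))%R.
  by rewrite !mulr_ge0 ?powR_ge0// addr_ge0// invr_ge0 ltW.
have kernel_le1 x : (1 <= Num.max (mdist u x) s)%R -> kernel s x <= 1.
  move=> /(kernel_le ltr01); by rewrite powR1.
have -> : riesz_kernel (alpha - gamma) s = (ln (expR 1 / Num.min s 1))%:E.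
  by rewrite b0 /riesz_kernel ltxx eqxx gt_eqF.
have [s1|s1] := leP 1%R s.
  rewrite divr1 expRK mule1.
  apply: (@le_trans _ _ (\int[mu]_x (cst 1 x))).
    apply: ge0_le_integral => //.
    - by move=> x _; exact: kernel_ge0.
    - exact: mkernel.
    - by move=> x _; apply: (kernel_le1 x); rewrite le_max s1 orbT.
  by rewrite probability_integral_cst lee_fin lerDl.
have [|J /andP[Js sJ]] := @dyadic_bounds _ s^-1;
  first by rewrite invf_ge1// ltW.
pose y k : R := (s * 2 ^+ k)%R.
have y0 k : (0 < y k)%R by rewrite mulr_gt0// exprn_gt0.
(* Layers past [J] start above height 1, where the kernel is at most 1 and the constant term
   suffices; their weight is set to 0. *)
pose w k : R := if (k <= J)%N then (y k `^ (- alpha))%R else 0%R.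
have w0 k : (0 <= w k)%R by rewrite /w; case: ifP => // _; exact: powR_ge0.
apply: (@le_trans _ _ (1 + c * (4 `^ gamma * J.+1%:R))%:E).
  apply: (layered_integral_le (w := w) (r := fun k => 4 * y k)%R) => //.
  - exact: mkernel.
  - by move=> x; exact: kernel_ge0.
  - by move=> k; rewrite mulr_gt0.
  - move=> x; have [/kernel_le1 k1|x1] := leP 1%R (Num.max (mdist u x) s).
      rewrite -[leLHS]adde0; apply: leeD => //.
      by apply: nneseries_ge0 => k _ _; rewrite lee_fin mulr_ge0.
    have sx : (s <= Num.max (mdist u x) s)%R by rewrite le_max lexx orbT.
    have [|k /andP[kx xk]] := @dyadic_bounds _ (Num.max (mdist u x) s / s).
      by rewrite ler_pdivlMr// mul1r.
    have kJ : (k <= J)%N.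
      rewrite -ltnS -(@ltr_eXn2l R 2%R) ?ltr1n//.
      apply: le_lt_trans kx _; apply: lt_trans sJ.
      by rewrite -[ltRHS]mul1r ltr_pM2r// invr_gt0.
    move: kx xk; rewrite ler_pdivlMr// ltr_pdivrMr// => kx xk.
    apply: (@le_layers _ _ _ _ _ k) => //.
    + apply: le_lt_trans (_ : Num.max (mdist u x) s < _)%R;
      first by rewrite le_max lexx.
      apply: lt_trans xk _; have := y0 k.
      by rewrite (_ : 2 ^+ k.+1 * s = 2 * y k)%R; [lra|rewrite /y exprS; ring].
    + by rewrite /w kJ; apply: kernel_le => //; rewrite /y mulrC.
  - move=> n; rewrite (eq_bigr (fun k =>
    if (k < J.+1)%N then 4 `^ gamma else 0)%R).
      by rewrite sum_if_ltn mulr_natr ler_wpMn2l ?powR_ge0// geq_minr.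
    move=> k _; rewrite /w ltnS; case: ifP => _; last by rewrite mul0r.
    by rewrite layer_weight// b0 oppr0 powRr0 mulr1.
rewrite lee_fin ln_div ?posrE ?expR_gt0// expRK.
have L0 : (0 <= - ln s)%R by rewrite oppr_ge0 ln_le0// ltW.
(* Logarithms are taken in $2^J\le1/s$. *)
have JL : (J%:R * ln 2 <= - ln s :> R)%R.
  by rewrite -lnV ?posrE// mulr_natl -lnXn// ler_ln ?posrE ?exprn_gt0 ?invr_gt0.
have J_le : (J%:R <= - ln s * (ln 2)^-1 :> R)%R by rewrite ler_pdivlMr.
have A0 : (0 <= c * 4 `^ gamma)%R by rewrite mulr_ge0 ?powR_ge0.
have i0 : (0 <= (ln 2)^-1 :> R)%R by rewrite invr_ge0 ltW.
rewrite mulrA -[J.+1%:R%R]natr1; move: J_le A0 i0 L0.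
move: (c * 4 `^ gamma)%R (ln 2)^-1%R (- ln s)%R (J%:R : R) =>
  A i L j jL A0 i0 L0.
have h1 : (A * j <= A * (L * i))%R by rewrite ler_wpM2l.
have h2 : (0 <= A * i)%R by rewrite mulr_ge0.
have h3 : (0 <= A * L)%R by rewrite mulr_ge0.
nra.
Qed.

End potential.

(** [C] is chosen before the space, the measure and the centre, since one constant must serve all
    points of the growth set. *)
Lemma riesz_potential_le (R : realType) (alpha gamma c : R) :
  (0 < alpha)%R -> (0 <= c)%R ->
  exists2 C : R, (0 < C)%R &
    forall (X : pmetricType R) (mu : probability (borel X) R) (u : X),
      (forall r, (0 < r)%R -> mu (ball u r) <= (c * r `^ gamma)%:E) ->
      forall s, (0 <= s)%R ->
        \int[mu]_x riesz_kernel alpha (Num.max (mdist u x) s)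
          <= C%:E * riesz_kernel (alpha - gamma) s.
Proof.
move=> a0 c0; have [b0|b0|b0] := ltgtP (alpha - gamma)%R 0%R.
- exists (1 + c * (4 `^ gamma / (1 - 2 `^ (- (gamma - alpha)))))%R.
    rewrite ltr_pwDl// mulr_ge0// divr_ge0 ?powR_ge0// subr_ge0.
    rewrite powRN invf_le1 ?powR_gt0// -[leLHS](powRr0 2) ler_powR ?ler1n//.
    by rewrite -oppr_le0 opprB ltW.
  move=> X mu u muB s _; rewrite /riesz_kernel b0 mule1.
  exact: riesz_potential_lt0.
- set A := (c * (4 `^ gamma / (1 - 2 `^ (- (alpha - gamma)))))%R.
  have A0 : (0 <= A)%R.
    rewrite mulr_ge0// divr_ge0 ?powR_ge0// subr_ge0.
    by rewrite powRN invf_le1 ?powR_gt0// -[leLHS](powRr0 2) ler_powR ?ler1n//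
      ltW.
  (* Adding 1 keeps the constant positive even if [c] is 0, so that its product with the infinite
     kernel value at [s = 0] is infinite. *)
  exists (1 + A)%R; first by rewrite ltr_pwDl.
  move=> X mu u muB s; rewrite le_eqVlt => /predU1P[<-|s0].
    rewrite [X in _ <= _ * X]/riesz_kernel ltNge (ltW b0) eqxx /=
      gt0_muley ?leey//.
    by rewrite lte_fin ltr_pwDl.
  apply: le_trans (riesz_potential_gt0 c0 muB a0 b0 s0) _.
  by apply: lee_wpmul2r; [exact: riesz_kernel_ge0|rewrite lee_fin lerDr].
- exists (1 + c * 4 `^ gamma * (1 + (ln 2)^-1))%R.
    rewrite ltr_pwDl// !mulr_ge0 ?powR_ge0// addr_ge0// invr_ge0 ltW//.
    by rewrite ln_gt0// ltr1n.
  move=> X mu u muB s; rewrite le_eqVlt => /predU1P[<-|s0]; last first.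
    exact: riesz_potential_eq0.
  rewrite [X in _ <= _ * X]/riesz_kernel b0 ltxx eqxx gt0_muley ?leey//.
  rewrite lte_fin ltr_pwDl// !mulr_ge0 ?powR_ge0// addr_ge0// invr_ge0 ltW//.
  by rewrite ln_gt0// ltr1n.
Qed.

(** * Energies and capacities *)

(** Passes from infimal energies to capacities, including the values 0 and [+oo]. *)
Lemma le_inve_mul (R : realType) (C : R) (x y : \bar R) :
  (0 < C)%R -> 0 <= x -> 0 <= y -> x <= C%:E * y -> y^-1 <= C%:E * x^-1.
Proof.
move=> C0; case: y => [y| |]//; last first.
  by move=> x0 _ _; rewrite invey mule_ge0 ?inve_ge0// lee_fin ltW.
case: x => [x| |]//; rewrite !lee_fin => x0 y0 xy.
rewrite !inver; have [_|xn0] := eqVneq x 0%R.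
  by rewrite gt0_muley ?leey// lte_fin.
have x1 : (0 < x)%R by rewrite lt_neqAle eq_sym xn0.
have y1 : (0 < y)%R by move: (lt_le_trans x1 xy); rewrite pmulr_rgt0.
by rewrite gt_eqF// lee_fin ler_pdivlMr// ler_pdivrMl// mulrC.
Qed.

Lemma carried_by_nonempty (R : realType) (X : pmetricType R) (G : set X) mu :
  carried_by G mu -> G !=set0.
Proof.
move=> muG; apply/set0P/eqP => G0; move: muG; rewrite /carried_by G0 /= setC0.
move=> [N [mN muN]] TN;
  have : mu N = 1 by rewrite (_ : N = setT) ?probability_setT// -subTset.
by rewrite muN => /eqP; rewrite eq_sym onee_eq0.
Qed.

(* Two distinct points of [G] at distance [D] make the growth condition
   available for all radii [r <= D]; for [r > D] it suffices that [mu] has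
   total mass 1. *)
Lemma supports_ball_growth_all_radii (R : realType) (X : pmetricType R)
    (G : set X) (gamma : R) :
  (0 < gamma)%R -> (forall a, G <> [set a]) -> supports_ball_growth G gamma ->
  exists2 mu, carried_by G mu & exists2 c, (0 < c)%R &
    forall a r, G a -> (0 < r)%R -> mu (ball a r) <= (c * r `^ gamma)%:E.
Proof.
move=> g0 G1 [mu muG [c c0 muc]]; exists mu => //.
have [a Ga] := carried_by_nonempty muG.
have [b Gb ba] : exists2 b, G b & b <> a.
  apply: contrapT => nb; apply: (G1 a); apply/seteqP; split => [b Gb|_ ->//].
  by apply: contrapT => ba; apply: nb; exists b.
have D0 : (0 < mdist a b)%R by rewrite mdist_gt0; apply/eqP => /esym.
exists (c + (mdist a b) `^ (- gamma))%R; first by rewrite addr_gt0// powR_gt0.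
move=> x r Gx r0; have [rD|Dr] := leP r (mdist a b).
  apply: le_trans (muc x r Gx r0 _) _.
    apply: (@le_trans _ _ (mdist a b)%:E); first by rewrite lee_fin.
    by apply: ereal_sup_ubound; exists a => //; exists b.
  by rewrite lee_fin ler_wpM2r ?powR_ge0// lerDl powR_ge0.
apply: (@le_trans _ _ 1).
  by apply: probability_le1; apply: open_measurable_borel; exact: open_mball.
rewrite lee_fin mulrDl -[leLHS]add0r lerD ?mulr_ge0 ?powR_ge0 ?(ltW c0)//.
rewrite powRN [(_^-1 * _)%R]mulrC ler_pdivlMr ?powR_gt0// mul1r.
by apply: ge0_ler_powR; rewrite ?nnegrE; apply: ltW.
Qed.

Lemma measurable_riesz_kernel_mdist (R : realType) (X : pmetricType R)
    (beta : R) (u : X) :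
  measurable_fun [set: borel X] (fun v : borel X =>
    riesz_kernel beta (mdist u v)).
Proof.
apply: measurableT_comp; first exact: measurable_riesz_kernel.
apply: continuous_measurable_borelR; exact: continuous_mdistr.
Qed.

(** The kernel is viewed as one Borel function on [X * X] with the maximum distance, so joint
    measurability comes from continuity of the distance and not from rectangles. *)
Lemma measurable_riesz_potential (R : realType) (X : pmetricType R) (beta : R)
    (nu : probability (borel X) R) :
  measurable_fun [set: borel X]
    (fun u => \int[nu]_v riesz_kernel beta (mdist (u : X) (v : X))).
Proof.
apply: (@measurable_fiber_integral _ X X (X * X)%type (fun v u => (u, v)) _ _ nu
  (fun p : borel (X * X)%type => riesz_kernel beta (mdist p.1 p.2))).
- by move=> v v' u; rewrite prod_mdistE /= mdistxx max_r ?mdist_ge0.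
- by move=> v u u'; rewrite prod_mdistE /= mdistxx max_l ?mdist_ge0.
- apply: measurableT_comp; first exact: measurable_riesz_kernel.
  by apply: continuous_measurable_borelR; exact: continuous_mdist.
- by move=> p; exact: riesz_kernel_ge0.
Qed.

(* [Z] with the projections [p], [q] is a copy of [X * Y] with the maximum
   distance; both [X1 * X2] and its mirror image [X2 * X1] are instances. *)
Section max_product.
Context {R : realType} {X Y Z : pmetricType R}.
Context (j : X -> Y -> Z) (p : Z -> X) (q : Z -> Y).
Hypothesis mdist_j : forall x x' y y',
  mdist (j x y) (j x' y') = Num.max (mdist x x') (mdist y y').
Hypothesis pj : forall x y, p (j x y) = x.
Hypothesis qj : forall x y, q (j x y) = y.
Hypothesis cp : continuous p.
Hypothesis cq : continuous q.

Let jl x x' y : (mdist (j x y) (j x' y) <= mdist x x')%R.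
Proof. by rewrite mdist_j mdistxx max_l ?mdist_ge0. Qed.

Let jr x y y' : (mdist (j x y) (j x y') <= mdist y y')%R.
Proof. by rewrite mdist_j mdistxx max_r ?mdist_ge0. Qed.

(** The complement of the product lies over the Borel null sets [N1] and [N2] that witness the two
    hypotheses, so [G1] and [G2] may be non-Borel. *)
Lemma carried_by_max_product (G1 : set X) (G2 : set Y)
    (mu : probability (borel X) R)
    (nu : probability (borel Y) R) (lam : probability (borel Z) R) :
  (forall f : borel Z -> \bar R, measurable_fun [set: borel Z] f ->
    (forall z, 0 <= f z) ->
    \int[lam]_z f z = \int[nu]_y \int[mu]_x f (j x y)) ->
  carried_by G1 mu -> carried_by G2 nu ->
  carried_by (p @^-1` G1 `&` q @^-1` G2) lam.
Proof.
move=> lamE [N1 [mN1 muN1 GN1]] [N2 [mN2 nuN2 GN2]].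
have lam_set (A : set (borel Z)) : measurable A ->
    lam A = \int[nu]_y mu ((j^~ y) @^-1` A).
  move=> mA; transitivity (\int[lam]_z (\1_A z)%:E).
    by rewrite integral_indic// setIT.
  rewrite lamE; last by move=> z; rewrite lee_fin.
    apply: eq_integral => y _.
    transitivity (\int[mu]_x (\1_((j^~ y) @^-1` A) x)%:E) => //.
    rewrite integral_indic ?setIT//; last first.
    rewrite -[X in measurable X]setTI; apply: continuous_measurable_borel => //.
    by apply: lipschitz1_continuous => x x'; exact: jl.
  by apply/measurable_EFinP; exact: measurable_indic.
have mp : measurable (p @^-1` N1 : set (borel Z)).
  rewrite -[X in measurable X]setTI.
  exact: (continuous_measurable_borel cp measurableT mN1).
have mq : measurable (q @^-1` N2 : set (borel Z)).
  rewrite -[X in measurable X]setTI.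
  exact: (continuous_measurable_borel cq measurableT mN2).
have lamp : lam (p @^-1` N1) = 0.
  rewrite lam_set//; apply: integral0_eq => y _; rewrite -[RHS]muN1.
  by congr (mu _); apply/seteqP; split => x /=; rewrite pj.
(* The fibre over [y] is all of [X] if [y] is in [N2] and empty otherwise, so its [mu]-mass is the
   indicator of [N2]. *)
have lamq : lam (q @^-1` N2) = 0.
  rewrite lam_set// -[RHS]nuN2 -[in RHS](setIT N2) -integral_indic//.
  apply: eq_integral => y _; rewrite indicE; have [yN2|yN2] := boolP (y \in N2).
    rewrite -[RHS](@probability_setT _ _ _ mu); congr (mu _).
    by apply/seteqP; split => // x _ /=; rewrite qj; exact: set_mem.
  rewrite -[RHS](measure0 mu); congr (mu _); apply/seteqP; split => // x /=.
  by rewrite qj => N2y; move: yN2; rewrite mem_set.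
have lampq : lam.-negligible (p @^-1` N1 `|` q @^-1` N2).
  by apply: negligibleU;
    [exists (p @^-1` N1); split|exists (q @^-1` N2); split].
apply: negligibleS lampq; rewrite setCI => z [/GN1|/GN2]; by [left|right].
Qed.

(** The potential of [lam] at [j x y] is bounded through the hypothesis with centre [x] and [s] the
    distance from [y] to [y']; what remains is the potential of [nu] at [y], free of [x]. *)
Lemma energy_max_product (G1 : set X) (mu : probability (borel X) R)
    (nu : probability (borel Y) R) (lam : probability (borel Z) R)
    (alpha beta C : R) :
  (forall f : borel Z -> \bar R, measurable_fun [set: borel Z] f ->
    (forall z, 0 <= f z) ->
    \int[lam]_z f z = \int[nu]_y \int[mu]_x f (j x y)) ->
  carried_by G1 mu -> (0 <= C)%R ->
  (forall u, G1 u -> forall s, (0 <= s)%R ->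
    \int[mu]_x riesz_kernel alpha (Num.max (mdist u x) s)
      <= C%:E * riesz_kernel beta s) ->
  energy alpha lam <= C%:E * energy beta nu.
Proof.
move=> lamE muG1 C0 muC.
pose E (z : borel Z) :=
  \int[lam]_z' riesz_kernel alpha (mdist (z : Z) (z' : Z)).
pose Phi (y : borel Y) :=
  \int[nu]_y' riesz_kernel beta (mdist (y : Y) (y' : Y)).
have E0 z : 0 <= E z by apply: integral_ge0 => ? _; exact: riesz_kernel_ge0.
have Phi0 y : 0 <= Phi y by apply: integral_ge0 => ? _; exact: riesz_kernel_ge0.
have mE : measurable_fun [set: borel Z] E by exact: measurable_riesz_potential.
have mPhi : measurable_fun [set: borel Y] Phi.
  exact: measurable_riesz_potential.
have EPhi x y : G1 x -> E (j x y) <= C%:E * Phi y.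
  move=> G1x; rewrite /E lamE; last by move=> z; exact: riesz_kernel_ge0.
    rewrite -ge0_integralZl ?lee_fin//.
    - apply: ge0_le_integral => //.
      + by move=> y' _; apply: integral_ge0 => ? _; exact: riesz_kernel_ge0.
      + apply: (@measurable_fiber_integral _ _ _ _ j jl jr mu
          (fun z : borel Z => riesz_kernel alpha (mdist (j x y) z))).
          exact: measurable_riesz_kernel_mdist.
        by move=> z; exact: riesz_kernel_ge0.
      + by apply: measurable_funeM; exact: measurable_riesz_kernel_mdist.
      + move=> y' _; under eq_integral do rewrite mdist_j.
        by apply: muC => //; exact: mdist_ge0.
    - exact: measurable_riesz_kernel_mdist.
    - by move=> y' _; exact: riesz_kernel_ge0.
  exact: measurable_riesz_kernel_mdist.
rewrite {1}/energy -/E lamE// -ge0_integralZl ?lee_fin//.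
apply: ge0_le_integral => //.
- by move=> y _; apply: integral_ge0 => x _; exact: E0.
- exact: (@measurable_fiber_integral _ _ _ _ j jl jr mu E).
- exact: measurable_funeM.
(* [EPhi] holds only for [x] in [G1], hence almost everywhere for [mu]; writing the right side as
   the [mu]-integral of a constant allows an almost everywhere comparison. *)
move=> y _; rewrite -[leRHS](probability_integral_cst mu).
apply: ae_ge0_le_integral => //.
- by move=> x _; exact: E0.
- apply: measurableT_comp mE _.
  by apply: continuous_measurable_borel; apply: lipschitz1_continuous => x x';
    exact: jl.
- by move=> x _; apply: mule_ge0; [rewrite lee_fin|exact: Phi0].
- move: muG1; apply: negligibleS => x; apply: contra_not => G1x _.
  exact: EPhi.
- by move=> y _; exact: Phi0.
Qed.

Lemma capacity_max_product (G1 : set X) (G2 : set Y) (alpha gamma : R) :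
  (0 < alpha)%R ->
  (0 < gamma)%R -> (forall a, G1 <> [set a]) -> supports_ball_growth G1 gamma ->
  exists2 C : R, (0 < C)%R & capacity (alpha - gamma) G2
    <= C%:E * capacity alpha (p @^-1` G1 `&` q @^-1` G2).
Proof.
move=> a0 g0 G1a /(supports_ball_growth_all_radii g0 G1a)[mu muG1 [c c0 muc]].
have [C C0 muC] := riesz_potential_le gamma a0 (ltW c0).
exists C => //; rewrite /capacity.
have energy0 (V : pmetricType R) b (m : probability (borel V) R) :
  0 <= energy b m.
  by apply: integral_ge0 => ? _; apply: integral_ge0 => ? _;
    exact: riesz_kernel_ge0.
set I2 := ereal_inf _; set I3 := ereal_inf _.
have I20 : 0 <= I2 by apply: le_ereal_inf_tmp => _ [? _ <-].
have I30 : 0 <= I3 by apply: le_ereal_inf_tmp => _ [? _ <-].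
(* Every [nu] carried by [G2] yields a competitor [lam] for the product. *)
have I3I2 : I3 <= C%:E * I2.
  rewrite -lee_pdivrMl//; apply: le_ereal_inf_tmp => _ [nu nuG2 <-].
  rewrite lee_pdivrMl//.
  have [lam lamE] := fiber_product_probability jl jr mu nu.
  apply: (@le_trans _ _ (energy alpha lam)).
    apply: ereal_inf_lbound; exists lam => //.
    exact: carried_by_max_product lamE muG1 nuG2.
  apply: (energy_max_product lamE muG1); first exact: ltW.
  by move=> u Gu; apply: muC => r r0; exact: muc.
exact: le_inve_mul.
Qed.

End max_product.

(** * Hausdorff measures *)

(** Both sides are the unordered sum of nonnegative terms over all pairs. *)
Lemma nneseries_nat2 (R : realType) (a : nat * nat -> \bar R)
    (e : {bij [set: nat] >-> [set: nat * nat]}) : (forall k, 0 <= a k) ->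
  \sum_(0 <= k <oo) a (e k) = \sum_(0 <= m <oo) \sum_(0 <= n <oo) a (m, n).
Proof.
move=> a0; rewrite nneseries_esumT//.
rewrite -(reindex_esum [set: nat] [set: nat * nat] e a); last exact: bij.
rewrite nneseries_esumT; last by move=> m; apply: nneseries_ge0.
under [RHS]eq_esum do rewrite nneseries_esumT//.
rewrite esum_esum//; congr esum; last by apply/funext => -[].
by apply/seteqP; split.
Qed.

(* [covering_growth] says nothing about radii above the diameter, which is all
   of them when [G] has at most one point. *)
Lemma covering_growth_small_radii (R : realType) (X : pmetricType R)
    (G : set X) (gamma : R) :
  (forall a, G = [set a] -> (0 <= gamma)%R) -> covering_growth G gamma ->
  exists2 c, (0 < c)%R & exists2 r0, (0 < r0)%R &
    forall r, (0 < r <= r0)%R -> exists N (x : nat -> X),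
      (G `<=` \bigcup_(i < N) ball (x i) r) /\ (N%:R <= c * r `^ (- gamma))%R.
Proof.
move=> G1 [c c0 Gc]; have [->|/set0P[a Ga]] := eqVneq G set0.
  exists 1%R => //; exists 1%R => // r _; exists 0%N, (fun=> point).
  by rewrite mul1r powR_ge0; split=> // x [].
have [[b Gb ba]|nb] := pselect (exists2 b, G b & b <> a); last first.
  have {}Ga : G = [set a].
    apply/seteqP; split => [b Gb|_ ->//].
    by apply: contrapT => ba; apply: nb; exists b.
  (* For $r\le1$ one ball is within the bound because $\gamma\ge0$ gives $r^{-\gamma}\ge1$. *)
  exists 1%R => //; exists 1%R => // r /andP[r0 r1]; exists 1%N, (fun=> a).
  split; last first.
    rewrite mul1r powRN invf_ge1 ?powR_gt0// -[leRHS](powRr0 r).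
    by rewrite ger_powR ?r0//; exact: G1 Ga.
  by rewrite Ga => _ ->; exists 0%N; [|exact: ballxx].
have D0 : (0 < mdist a b)%R by rewrite mdist_gt0; apply/eqP => /esym.
(* Doubling [c] makes the bound on the infimum strict, so some actual cover lies below it. *)
exists (2 * c)%R; first by rewrite mulr_gt0.
exists (mdist a b) => // r /andP[r0 rD].
have : covering_number G r < (2 * c * r `^ (- gamma))%:E.
  apply: le_lt_trans (Gc r r0 _) _.
    apply: (@le_trans _ _ (mdist a b)%:E); first by rewrite lee_fin.
    by apply: ereal_sup_ubound; exists a => //; exists b.
  by rewrite lte_fin -mulrA ltr_pMl ?mulr_gt0 ?powR_gt0// ltr1n.
by move=> /ereal_inf_lt[_ [N [x GN] <-]]; rewrite lte_fin => /ltW; exists N, x.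
Qed.

Lemma is_cvg_hausdorff_content (R : realType) (X : pmetricType R) (beta : R)
    (G : set X) :
  cvg (hausdorff_content beta delta G @[delta --> (0 : R)^'+]).
Proof.
apply: nonincreasing_at_right_is_cvge; apply: nearW => b d e _ _ de.
apply: le_ereal_inf => _ [xr [xrd Gxr] <-]; exists xr => //; split => // n.
by have /andP[-> /le_trans->] := xrd n.
Qed.

(** * Hausdorff contents and measures of products *)

Section max_product_hausdorff.
Context {R : realType} {X Y Z : pmetricType R}.
Context (j : X -> Y -> Z) (p : Z -> X) (q : Z -> Y).
Hypothesis mdist_j : forall x x' y y',
  mdist (j x y) (j x' y') = Num.max (mdist x x') (mdist y y').
Hypothesis jpq : forall z, j (p z) (q z) = z.
Variables (G1 : set X) (G2 : set Y) (alpha gamma : R).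
Hypothesis alpha0 : (0 < alpha)%R.

Lemma hausdorff_content_max_product (c r0 delta : R) : (0 < c)%R ->
  (forall r, (0 < r <= r0)%R -> exists N (x : nat -> X),
    (G1 `<=` \bigcup_(i < N) ball (x i) r) /\ (N%:R <= c * r `^ (- gamma))%R) ->
  (0 < delta <= r0)%R ->
  hausdorff_content alpha delta (p @^-1` G1 `&` q @^-1` G2) <=
  (c * 2 `^ gamma)%:E * hausdorff_content (alpha - gamma) delta G2.
Proof.
move=> c0 G1c /andP[d0 dr].
have C0 : (0 < c * 2 `^ gamma)%R by rewrite mulr_gt0// powR_gt0.
rewrite -lee_pdivrMl//; apply: le_ereal_inf_tmp => _ [[y r] [/= rd G2r] <-].
rewrite lee_pdivrMl// -nneseriesZl; last first.
  by move=> n _; rewrite lee_fin powR_ge0.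
(* [Nx n] packs the number of balls used for [G1] at radius [r n] and their centres; when [r n] is 0
   the ball in the cover of [G2] is empty and no ball is used. *)
have /choice[Nx Nx_cover] : forall n, exists Nx : nat * (nat -> X),
    ((0 < r n)%R -> G1 `<=` \bigcup_(i < Nx.1) ball (Nx.2 i) (r n)) /\
    (Nx.1%:R * (2 * r n) `^ alpha
      <= c * 2 `^ gamma * (2 * r n) `^ (alpha - gamma))%R.
  move=> n; have /andP[] := rd n; rewrite le_eqVlt => /predU1P[<- _|rn0 rnd].
    exists (0%N, fun=> point); rewrite ltxx mul0r; split => //=.
    by rewrite !mulr_ge0 ?powR_ge0// ltW.
  have [|N [x [G1x Nc]]] := G1c (r n); first by rewrite rn0 (le_trans rnd).
  exists (N, x); split => //=.
  apply: le_trans (ler_wpM2r (powR_ge0 _ _) Nc) _.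
  have tg : (2 `^ gamma != 0 :> R)%R by rewrite gt_eqF// powR_gt0.
  have r2 : (2 * r n != 0)%R by rewrite gt_eqF// mulr_gt0.
  rewrite powRD ?r2 ?implybT// [((2 * r n) `^ (- gamma))%R]powRM ?(ltW rn0)//.
  rewrite [(2 `^ (- gamma))%R]powRN le_eqVlt; apply/orP; left; apply/eqP.
  by field.
have /card_esym/ppcard_eqP[e] := card_nat2.
pose cz (k : nat * nat) := j ((Nx k.1).2 k.2) (y k.1).
(* Indices past the number of balls get radius 0: such balls are empty and cost nothing, since
   [alpha] is positive. *)
pose rz (k : nat * nat) := if (k.2 < (Nx k.1).1)%N then r k.1 else 0%R.
apply: (@le_trans _ _ (\sum_(0 <= k <oo) ((2 * rz (e k)) `^ alpha)%:E)).
  apply: ereal_inf_lbound; exists (cz \o e, rz \o e) => //=; split.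
    move=> k; rewrite /rz; case: ifP => _; first exact: rd.
    by rewrite lexx ltW.
  move=> z [/= G1z /G2r[n _]]; rewrite ballEmdist /= => ynz.
  (* A ball that contains a point has positive radius, which gives access to the cover of [G1]. *)
  have rn0 : (0 < r n)%R by apply: le_lt_trans ynz; exact: mdist_ge0.
  have [/(_ rn0 _ G1z)[i /= iN xiz] _] := Nx_cover n.
  exists (e^-1%FUN (n, i)) => //=; rewrite invK ?inE//.
  rewrite /cz /rz /= iN ballEmdist /= -[z]jpq mdist_j gt_max ynz andbT.
  by move: xiz; rewrite ballEmdist.
rewrite (nneseries_nat2 (a := fun k => ((2 * rz k) `^ alpha)%:E)); last first.
  by move=> k; rewrite lee_fin powR_ge0.
apply: lee_nneseries => [n _ _|n _].
  by apply: nneseries_ge0 => i _ _; rewrite lee_fin powR_ge0.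
rewrite -EFinM; apply: nneseries_le_bound => [i|k]; first exact: powR_ge0.
have [_] := Nx_cover n; apply: le_trans.
rewrite (eq_bigr (fun i =>
  if (i < (Nx n).1)%N then (2 * r n) `^ alpha else 0)%R).
  by rewrite sum_if_ltn [leRHS]mulr_natl ler_wpMn2l ?powR_ge0// geq_minr.
by move=> i _; rewrite /rz /=; case: ifP => // _; rewrite mulr0 powR0 ?gt_eqF.
Qed.

Lemma hausdorff_measure_max_product :
  (forall a, G1 = [set a] -> (0 <= gamma)%R) -> covering_growth G1 gamma ->
  exists2 C : R, (0 < C)%R &
    hausdorff_measure alpha (p @^-1` G1 `&` q @^-1` G2)
      <= C%:E * hausdorff_measure (alpha - gamma) G2.
Proof.
move=> G1a /(covering_growth_small_radii G1a)[c c0 [r0 r00 G1c]].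
exists (c * 2 `^ gamma)%R; first by rewrite mulr_gt0// powR_gt0.
rewrite /hausdorff_measure -limeMl//; last exact: is_cvg_hausdorff_content.
apply: lee_lim.
- exact: is_cvg_hausdorff_content.
- by apply: is_cvgeZl => //; exact: is_cvg_hausdorff_content.
(* The contents are compared only for [d <= r0], which is enough in the limit at 0. *)
near=> d; apply: hausdorff_content_max_product c0 G1c _.
by apply/andP; split; near: d; [exact: nbhs_right_gt|exact: nbhs_right_le].
Unshelve. all: by end_near. Qed.

End max_product_hausdorff.

(* If G1 = [set a] then diam G1 = 0, so the growth hypotheses are vacuous and
   the conclusions fail in general (for covering_growth only when gamma' < 0).
   The two hypotheses on singletons exclude exactly this case; likewise for
   G2. *)
Theorem proposition2p1 (R : realType) (X1 X2 : pmetricType R) (alpha : R)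
    (G1 : set X1) (G2 : set X2) :
  (0 < alpha)%R ->
  [/\ forall gamma : R, (0 < gamma)%R ->
        (forall a, G1 <> [set a]) ->
        supports_ball_growth G1 gamma ->
        exists2 c2 : R, (0 < c2)%R &
          capacity (alpha - gamma) G2 <= c2%:E * capacity alpha (G1 `*` G2),
      forall gamma' : R, (gamma' < alpha)%R ->
        (forall a, G1 = [set a] -> (0 <= gamma')%R) ->
        covering_growth G1 gamma' ->
        exists2 c4 : R, (0 < c4)%R &
          hausdorff_measure alpha (G1 `*` G2)
            <= c4%:E * hausdorff_measure (alpha - gamma') G2,
      forall gamma : R, (0 < gamma)%R ->
        (forall a, G2 <> [set a]) ->
        supports_ball_growth G2 gamma ->
        exists2 c5 : R, (0 < c5)%R &
          capacity (alpha - gamma) G1 <= c5%:E * capacity alpha (G1 `*` G2) &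
      forall gamma' : R, (gamma' < alpha)%R ->
        (forall a, G2 = [set a] -> (0 <= gamma')%R) ->
        covering_growth G2 gamma' ->
        exists2 c6 : R, (0 < c6)%R &
          hausdorff_measure alpha (G1 `*` G2)
            <= c6%:E * hausdorff_measure (alpha - gamma') G1].
Proof.
move=> alpha0.
have fst1 (z w : X1 * X2) : (mdist z.1 w.1 <= mdist z w)%R.
  by rewrite prod_mdistE le_max lexx.
have snd1 (z w : X1 * X2) : (mdist z.2 w.2 <= mdist z w)%R.
  by rewrite prod_mdistE le_max lexx orbT.
have cfst := lipschitz1_continuous fst1;
  have csnd := lipschitz1_continuous snd1.
(* For the exchanged roles, the same product is viewed through swapped projections. *)
have GE : G1 `*` G2 = snd @^-1` G2 `&` fst @^-1` G1 by rewrite setIC.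
have swapE (x x' : X2) (y y' : X1) :
    mdist (y, x) (y', x') = Num.max (mdist x x') (mdist y y').
  by rewrite prod_mdistE /= maxC.
split=> [g g0 G1a G1g|g ga G1a G1g|g g0 G2a G2g|g ga G2a G2g].
- exact: (capacity_max_product (j := pair) (p := fst) (q := snd)).
- by apply: (hausdorff_measure_max_product
    (j := pair) (p := fst) (q := snd)) => // -[].
- rewrite GE.
  exact: (capacity_max_product (j := fun x y => (y, x)) (p := snd) (q := fst)).
- rewrite GE; by apply: (hausdorff_measure_max_product
    (j := fun x y => (y, x)) (p := snd) (q := fst)) => // -[].
Qed.
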